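(* (Second Isomorphism Theorem) Let $(M,\alpha)$ and $(N,\alpha)$ be two Hom-normal subgroups of a Hom-group $(G,\alpha)$, and let $(N,\alpha)$ be a Hom-subgroup of $(M,\alpha)$. Then $(M/N,\widetilde{\alpha})$ is a Hom-normal subgroup of $(G/N,\widetilde{\alpha})$ and $(G/N)/(M/N)\cong G/M$ as Hom-groups.
   Context: A Hom-group $(G,\alpha)$ is a set $G$ together with a distinguished element $1\in G$ (the unit), a bijective map $\alpha:G\to G$ and a binary operation $G\times G\to G$, $(g,h)\mapsto gh$, such that for all $g,h,k\in G$: (1) $\alpha(g)(hk)=(gh)\alpha(k)$; (2) $\alpha(gh)=\alpha(g)\alpha(h)$; (3) $g1=1g=\alpha(g)$; (4) there exists $g^{-1}\in G$ with $gg^{-1}=g^{-1}g=1$. A Hom-subgroup of a Hom-group $(G,\alpha)$ is a nonempty subset $H\subseteq G$ closed under the product such that $(H,\alpha)$ (with $\alpha$ restricted to a bijection $H\to H$) is itself a Hom-group under the product of $G$. It is Hom-normal if $gH=Hg$ for every $g\in G$, where $gH=\{gh\mid h\in H\}$ and $Hg=\{hg\mid h\in H\}$. For $N$ Hom-normal in $G$, $G/N$ denotes the Hom-group of left cosets $gN$, with product $(aN)(bN)=(ab)N$ and twisting map $\widetilde{\alpha}(aN)=\alpha(a)N$; $M/N=\{mN\mid m\in M\}$. A homomorphism of Hom-groups $f:(G,\alpha)\to(G',\beta)$ is a map with $f(gk)=f(g)f(k)$ for all $g,k$ and $\beta(f(g))=f(\alpha(g))$ for all $g$; it is an isomorphism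 if bijective, and $\cong$ means that an isomorphism exists. *)

(* Defs.v *)
From mathcomp Require Import all_boot.
From mathcomp Require Import boolp classical_sets functions.

Set Implicit Arguments.
Unset Strict Implicit.
Unset Printing Implicit Defensive.

Local Open Scope classical_set_scope.

Declare Scope hom_group_scope.
Delimit Scope hom_group_scope with hg.

(* The Hom-group axioms relativized to a subset A of the ambient type: Hom-groups
   are the case A = setT, Hom-subgroups are arbitrary A with the same operations. *)
Record hom_group_on (T : Type) (A : set T) (e : T) (mul : T -> T -> T)
    (alpha : T -> T) : Prop := HomGroupOn {
  hg_unit : A e;
  hg_alpha : set_bij A A alpha;
  hg_closed : forall g h, A g -> A h -> A (mul g h);
  hg_assoc : forall g h k, A g -> A h -> A k ->
    mul (alpha g) (mul h k) = mul (mul g h) (alpha k);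
  hg_alphaM : forall g h, A g -> A h -> alpha (mul g h) = mul (alpha g) (alpha h);
  hg_mul1 : forall g, A g -> mul g e = alpha g /\ mul e g = alpha g;
  hg_inv : forall g, A g -> exists2 h, A h & mul g h = e /\ mul h g = e
}.

Record homGroup := HomGroup {
  hcarrier :> Type;
  hone : hcarrier;
  hmul : hcarrier -> hcarrier -> hcarrier;
  hcalpha : hcarrier -> hcarrier;
  hgroupP : hom_group_on [set: hcarrier] hone hmul hcalpha
}.
Arguments hone {h}.
Arguments hmul {h} _ _.
Arguments hcalpha {h} _.

Notation "g ** h" := (hmul g h) (at level 40, left associativity) : hom_group_scope.
Local Open Scope hom_group_scope.

(* H is a Hom-subgroup of K, where K is setT or itself a Hom-subgroup of G. The
   unit e of H is not assumed to be the unit of G. *)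
Definition hom_subgroup (G : homGroup) (H K : set G) : Prop :=
  [/\ H `<=` K, H !=set0, (forall g h, H g -> H h -> H (g ** h))
    & exists e : G, hom_group_on H e hmul hcalpha].

Definition hlcoset (G : homGroup) (g : G) (H : set G) : set G :=
  [set g ** h | h in H].

Definition hrcoset (G : homGroup) (H : set G) (g : G) : set G :=
  [set h ** g | h in H].

Definition hom_normal (G : homGroup) (H : set G) : Prop :=
  forall g : G, hlcoset g H = hrcoset H g.

Definition hom_normal_subgroup (G : homGroup) (H : set G) : Prop :=
  hom_subgroup H [set: G] /\ hom_normal H.

Record hom_morphism (G G' : homGroup) (f : G -> G') : Prop := HomMorphism {
  hmorphM : forall g k : G, f (g ** k) = f g ** f k;
  hmorph_alpha : forall g : G, hcalpha (f g) = f (hcalpha g)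
}.

Definition hom_isomorphic (G G' : homGroup) : Prop :=
  exists2 f : G -> G', hom_morphism f & bijective f.

Section HomGroupTheory.
Variable G : homGroup.
Implicit Types g h k : G.

Lemma halpha_inj : injective (@hcalpha G).
Proof. by move=> x y; have [_ I _] := hg_alpha (hgroupP G); apply: I; rewrite inE. Qed.

Lemma halpha_surj g : exists h, hcalpha h = g.
Proof. by have [_ _ /(_ g I)[h _ <-]] := hg_alpha (hgroupP G); exists h. Qed.

Lemma hmulA g h k : hcalpha g ** (h ** k) = (g ** h) ** hcalpha k.
Proof. exact: hg_assoc (hgroupP G) _ _ _ I I I. Qed.

Lemma halphaM g h : hcalpha (g ** h) = hcalpha g ** hcalpha h.
Proof. exact: hg_alphaM (hgroupP G) _ _ I I. Qed.

Lemma hmulg1 g : g ** hone = hcalpha g.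
Proof. by case: (hg_mul1 (hgroupP G) (g := g) I). Qed.

Lemma hmul1g g : hone ** g = hcalpha g.
Proof. by case: (hg_mul1 (hgroupP G) (g := g) I). Qed.

Lemma hmul_inv g : exists h, g ** h = hone /\ h ** g = hone.
Proof. by have [h _ ?] := hg_inv (hgroupP G) (g := g) I; exists h. Qed.

Lemma hmulgI g : injective (hmul g).
Proof.
move=> x y exy; have [g' [_ g'g]] := hmul_inv g.
apply/halpha_inj/halpha_inj.
by rewrite -!(hmul1g (hcalpha _)) -g'g -!hmulA exy.
Qed.

Lemma halpha1 : hcalpha hone = hone :> G.
Proof. by apply: (@hmulgI (hcalpha hone)); rewrite -halphaM !hmulg1. Qed.

Section Subgroup.
Variable N : set G.
Hypothesis nN : hom_normal_subgroup N.

Lemma hsubM g h : N g -> N h -> N (g ** h).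
Proof. by case: nN => -[_ _ + _] _; apply. Qed.

Lemma hsub_alpha g : N g -> N (hcalpha g).
Proof. by case: nN => -[_ _ _ [e [_ [+ _ _] _ _ _ _ _]]] _; apply. Qed.

Lemma hsub_alphaV g : N g -> exists2 h, N h & hcalpha h = g.
Proof.
case: nN => -[_ _ _ [e [_ [_ _ S] _ _ _ _ _]]] _ /S [h Nh <-].
by exists h.
Qed.

Lemma hsub1 : N hone.
Proof.
case: nN => -[_ _ _ [e [Ne _ _ _ _ /(_ e Ne)[ee _] _]]] _.
have <- // : e = hone by apply: (@hmulgI e); rewrite ee hmulg1.
Qed.

Lemma hsubV g : N g -> exists2 h, N h & g ** h = hone /\ h ** g = hone.
Proof.
case: nN => -[_ _ _ [e [Ne _ _ _ _ /(_ e Ne)[ee _] iN]]] _ /iN[h Nh [gh hg]].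
have <- : e = hone by apply: (@hmulgI e); rewrite ee hmulg1.
by exists h.
Qed.

Lemma hnormal_swap n g : N n -> exists2 n', N n' & n ** g = g ** n'.
Proof.
case: nN => _ /(_ g) E Nn.
have : hrcoset N g (n ** g) by exists n.
by rewrite -E => -[n' Nn' <-]; exists n'.
Qed.

Lemma hlcoset_sub g h : hlcoset g N (hcalpha h) -> hlcoset h N `<=` hlcoset g N.
Proof.
move=> [n Nn gn] _ [k Nk <-].
have [p Np pE] := hsub_alphaV (hsubM Nn Nk).
exists p => //; apply: halpha_inj.
by rewrite !halphaM -gn -hmulA pE.
Qed.

Lemma hlcoset_sym g h : hlcoset g N (hcalpha h) -> hlcoset h N (hcalpha g).
Proof.
move=> [n /hsubV[n' Nn' [nn' _]] gn]; exists n' => //.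
by apply: halpha_inj; rewrite halphaM -gn -hmulA nn' hmulg1.
Qed.

Lemma hlcoset_eqP g h :
  hlcoset g N = hlcoset h N <-> hlcoset g N (hcalpha h).
Proof.
split=> [->|gh]; first by exists hone; [exact: hsub1 | rewrite hmulg1].
by rewrite eqEsubset; split; apply: hlcoset_sub => //; exact: hlcoset_sym.
Qed.

Lemma hlcosetM a b a' b' : hlcoset a N = hlcoset a' N ->
  hlcoset b N = hlcoset b' N -> hlcoset (a ** b) N = hlcoset (a' ** b') N.
Proof.
move=> /hlcoset_eqP[n /hsub_alphaV[n0 Nn0 <-] an].
move=> /hlcoset_eqP[m /hsub_alphaV[m0 Nm0 <-] bm].
apply/hlcoset_eqP; have [b0 bE] := halpha_surj b.
have [q Nq qE] := hnormal_swap b0 Nn0.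
exists (hcalpha (q ** m0)); first exact/hsub_alpha/hsubM.
rewrite (halphaM a') -an -bm -bE -halphaM -!hmulA.
by rewrite [hcalpha n0 ** _]hmulA qE -hmulA.
Qed.

Lemma hlcoset_alpha a b :
  hlcoset a N = hlcoset b N <-> hlcoset (hcalpha a) N = hlcoset (hcalpha b) N.
Proof.
split=> /hlcoset_eqP[n Nn an]; apply/hlcoset_eqP.
  by exists (hcalpha n); [exact: hsub_alpha | rewrite -halphaM an].
have [m Nm mE] := hsub_alphaV Nn; exists m => //.
by apply: halpha_inj; rewrite halphaM mE.
Qed.

End Subgroup.
End HomGroupTheory.

Definition coset_type (G : homGroup) (N : set G) : Type :=
  set_type (range (fun g : G => hlcoset g N)).

Definition hcoset (G : homGroup) (N : set G) (g : G) : coset_type N :=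
  exist _ (hlcoset g N) (mem_set (ex_intro2 _ _ g I (erefl (hlcoset g N)))).

Lemma hcoset_repr_ex (G : homGroup) (N : set G) (A : coset_type N) :
  exists g : G, hcoset N g = A.
Proof.
case: A => A mA; have [g _ gA] := set_mem mA.
by exists g; apply: val_inj.
Qed.

Definition hcoset_repr (G : homGroup) (N : set G) (A : coset_type N) : G :=
  projT1 (cid (hcoset_repr_ex A)).

Lemma hcoset_reprK (G : homGroup) (N : set G) (A : coset_type N) :
  hcoset N (hcoset_repr A) = A.
Proof. by rewrite /hcoset_repr; case: cid. Qed.

(* Defined through arbitrary representatives; independence of the choice is
   hcoset_mulE and hcoset_alphaE below. *)
Definition hcoset_mul (G : homGroup) (N : set G) (A B : coset_type N) :=
  hcoset N (hcoset_repr A ** hcoset_repr B).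

Definition hcoset_alpha (G : homGroup) (N : set G) (A : coset_type N) :=
  hcoset N (hcalpha (hcoset_repr A)).

Section Quotient.
Variables (G : homGroup) (N : set G).
Hypothesis nN : hom_normal_subgroup N.

Lemma hcoset_eqP (a b : G) :
  hcoset N a = hcoset N b <-> hlcoset a N = hlcoset b N.
Proof. by split=> [[]//|ab]; apply: val_inj. Qed.

Lemma hcoset_mulE (a b : G) :
  hcoset_mul (hcoset N a) (hcoset N b) = hcoset N (a ** b).
Proof. by apply/hcoset_eqP/(hlcosetM nN); apply/hcoset_eqP/hcoset_reprK. Qed.

Lemma hcoset_alphaE (a : G) :
  hcoset_alpha (hcoset N a) = hcoset N (hcalpha a).
Proof.
by apply/hcoset_eqP; rewrite -(hlcoset_alpha nN); apply/hcoset_eqP/hcoset_reprK.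
Qed.

Lemma quotient_hom_group :
  hom_group_on [set: coset_type N] (hcoset N hone)
    (@hcoset_mul G N) (@hcoset_alpha G N).
Proof.
split=> //.
- split=> //.
  + move=> A B _ _; rewrite -(hcoset_reprK A) -(hcoset_reprK B) !hcoset_alphaE.
    by move=> /hcoset_eqP; rewrite -(hlcoset_alpha nN) => /hcoset_eqP.
  + move=> A _; rewrite -(hcoset_reprK A).
    have [b <-] := halpha_surj (hcoset_repr A).
    by exists (hcoset N b); rewrite ?hcoset_alphaE.
- move=> A B C _ _ _.
  rewrite -(hcoset_reprK A) -(hcoset_reprK B) -(hcoset_reprK C).
  by rewrite !(hcoset_alphaE, hcoset_mulE) hmulA.
- move=> A B _ _; rewrite -(hcoset_reprK A) -(hcoset_reprK B).
  by rewrite !(hcoset_alphaE, hcoset_mulE) halphaM.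
- move=> A _; rewrite -(hcoset_reprK A).
  by rewrite !(hcoset_alphaE, hcoset_mulE) hmulg1 hmul1g.
- move=> A _; rewrite -(hcoset_reprK A).
  have [b [ab ba]] := hmul_inv (hcoset_repr A).
  by exists (hcoset N b); rewrite // !hcoset_mulE ab ba.
Qed.

(* G/N; its carrier is the set of left cosets of N in G. *)
Definition quotient : homGroup := HomGroup quotient_hom_group.

(* M/N, as a subset of G/N *)
Definition quotient_set (M : set G) : set quotient := [set hcoset N m | m in M].

End Quotient.

Arguments quotient {G N} nN.
Arguments quotient_set {G N} nN M.

(* Main.v *)
Require Import Defs.
From mathcomp Require Import all_boot.
From mathcomp Require Import boolp classical_sets functions.

(** Write [p : G -> G/N] for the projection.  As [p] is a surjective
    homomorphism, it carries Hom-subgroups to Hom-subgroups and, because it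
    carries the cosets [gH] and [Hg] to [p(g)p(H)] and [p(H)p(g)], Hom-normal
    ones to Hom-normal ones; hence [M/N = p(M)] is Hom-normal in [G/N].

    Both [(G/N)/(M/N)] and [G/M] are then surjective homomorphic images of [G].
    Two such images are isomorphic as soon as the two maps identify the same
    pairs of elements ([hom_isomorphic_same_fibers]), so all that remains is
    that [p(a)p(M) = p(b)p(M)] exactly when [aM = bM]
    ([hlcoset_image_eq]); this is where [N] being contained in [M]
    enters.  Working with fibers keeps well-definedness on cosets of cosets out
    of the argument, and replaces the usual computation of a kernel. *)

Local Open Scope classical_set_scope.
Local Open Scope hom_group_scope.

Section Morphism.
Variables (G Q : homGroup) (p : G -> Q).
Hypothesis pM : hom_morphism p.

Lemma hlcoset_image (H : set G) (g : G) :
  hlcoset (p g) (p @` H) = p @` hlcoset g H.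
Proof.
rewrite eqEsubset; split=> [_ [_ [h Hh <-] <-]|_ [_ [h Hh <-] <-]].
  by exists (g ** h); [exists h | rewrite (hmorphM pM)].
by exists (p h); [exists h | rewrite (hmorphM pM)].
Qed.

Lemma hrcoset_image (H : set G) (g : G) :
  hrcoset (p @` H) (p g) = p @` hrcoset H g.
Proof.
rewrite eqEsubset; split=> [_ [_ [h Hh <-] <-]|_ [_ [h Hh <-] <-]].
  by exists (h ** g); [exists h | rewrite (hmorphM pM)].
by exists (p h); [exists h | rewrite (hmorphM pM)].
Qed.

(** The unit, inverses and surjectivity of the twisting map are transported
    from [H] along [p]; its injectivity and the identities between products are
    inherited from [Q]. *)
Lemma hom_subgroup_image (H : set G) :
  hom_subgroup H [set: G] -> hom_subgroup (p @` H) [set: Q].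
Proof.
move=> [_ H0 HM [e [He [aH _ aS] _ _ _ H1 HV]]].
have pHM x y : (p @` H) x -> (p @` H) y -> (p @` H) (x ** y).
  move=> [g Hg <-] [h Hh <-]; rewrite -(hmorphM pM).
  by exists (g ** h) => //; exact: HM.
split=> //; first by have [h Hh] := H0; exists (p h), h.
exists (p e); split=> //.
- split=> [_ [h Hh <-]|x y _ _ /halpha_inj//|_ [h Hh <-]].
    by exists (hcalpha h); [exact: aH | rewrite (hmorph_alpha pM)].
  have [k Hk <-] := aS h Hh.
  by exists (p k); [exists k | rewrite (hmorph_alpha pM)].
- by move=> x y z _ _ _; exact: hmulA.
- by move=> x y _ _; exact: halphaM.
- move=> _ [h Hh <-]; have [he eh] := H1 h Hh.
  by rewrite -!(hmorphM pM) he eh (hmorph_alpha pM).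
- move=> _ [h Hh <-]; have [k Hk [hk kh]] := HV h Hh.
  by exists (p k); [exists k | rewrite -!(hmorphM pM) hk kh].
Qed.

Lemma hom_normal_subgroup_image (H : set G) : (forall x, exists g, p g = x) ->
  hom_normal_subgroup H -> hom_normal_subgroup (p @` H).
Proof.
move=> pS [sH nH]; split=> [|x]; first exact: hom_subgroup_image.
by have [g <-] := pS x; rewrite hlcoset_image hrcoset_image nH.
Qed.

End Morphism.

Arguments hlcoset_image {G Q p} pM H g.
Arguments hom_normal_subgroup_image {G Q p} pM {H} _ _.

Lemma hom_morphism_comp {G Q R : homGroup} {p : G -> Q} {r : Q -> R} :
  hom_morphism p -> hom_morphism r -> hom_morphism (r \o p).
Proof.
move=> pM rM; split=> [g k|g] /=; first by rewrite (hmorphM pM) (hmorphM rM).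
by rewrite (hmorph_alpha rM) (hmorph_alpha pM).
Qed.

(** The isomorphism sends [p g] to [r g]: the fiber condition makes it well
    defined and injective. *)
Lemma hom_isomorphic_same_fibers (G Q R : homGroup) (p : G -> Q) (r : G -> R) :
  hom_morphism p -> hom_morphism r ->
  (forall x, exists g, p g = x) -> (forall y, exists g, r g = y) ->
  (forall a b, p a = p b <-> r a = r b) -> hom_isomorphic Q R.
Proof.
move=> pM rM /choice[p' p'K] /choice[r' r'K] pr.
have fE g : r (p' (p g)) = r g by apply/pr; rewrite p'K.
exists (r \o p').
  split=> [x y|x] /=.
    by rewrite -{1}(p'K x) -{1}(p'K y) -(hmorphM pM) fE (hmorphM rM).
  by rewrite -{2}(p'K x) (hmorph_alpha pM) fE (hmorph_alpha rM).
exists (p \o r') => [x|y] /=; last by rewrite fE r'K.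
by rewrite -[RHS]p'K; apply/pr; rewrite r'K.
Qed.

Section Projection.
Variables (G : homGroup) (N : set G).
Hypothesis nN : hom_normal_subgroup N.

Definition quotient_proj : G -> quotient nN := hcoset N.

Lemma quotient_projM : hom_morphism quotient_proj.
Proof.
by split=> *; [exact/esym/(hcoset_mulE nN) | exact: (hcoset_alphaE nN)].
Qed.

Lemma quotient_proj_surj (A : quotient nN) : exists g, quotient_proj g = A.
Proof. exact: hcoset_repr_ex. Qed.

Lemma quotient_proj_eqP (a b : G) :
  quotient_proj a = quotient_proj b <-> hlcoset a N = hlcoset b N.
Proof. exact: hcoset_eqP. Qed.

End Projection.

Arguments quotient_proj {G N} nN g.
Arguments quotient_projM {G N} nN.
Arguments quotient_proj_surj {G N} nN A.
Arguments quotient_proj_eqP {G N} nN a b.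

(** If [p(a)p(M)] contains [p(alpha b)], then [alpha b] and some [am] agree
    modulo [N], that is [alpha (alpha b) = (am)n].  Hom-associativity turns the
    right-hand side into [(alpha a)(mn')] with [alpha n' = n], and [mn'] is in
    [M]; so [a] and [b] are congruent modulo [M] after one application of the
    twisting map, which cosets do not notice. *)
Lemma hlcoset_image_eq (G : homGroup) (M N : set G)
    (nM : hom_normal_subgroup M) (nN : hom_normal_subgroup N)
    (nMN : hom_normal_subgroup (quotient_set nN M)) (a b : G) : N `<=` M ->
  hlcoset (quotient_proj nN a) (quotient_set nN M) =
    hlcoset (quotient_proj nN b) (quotient_set nN M) <->
  hlcoset a M = hlcoset b M.
Proof.
move=> NM; have pM := quotient_projM nN.
split; last first.
  by rewrite !(hlcoset_image pM) => ->.
move=> /(hlcoset_eqP nMN); rewrite (hlcoset_image pM) (hmorph_alpha pM).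
move=> [_ [m Mm <-] /quotient_proj_eqP /(hlcoset_eqP nN)[n Nn E]].
have [n' Nn' n'E] := hsub_alphaV nN Nn.
apply/(hlcoset_alpha nM)/(hlcoset_eqP nM).
exists (m ** n'); first by apply: (hsubM nM) => //; exact: NM.
by rewrite hmulA n'E.
Qed.

Theorem theorem5p13 (G : homGroup) (M N : set G)
    (nM : hom_normal_subgroup M) (nN : hom_normal_subgroup N)
    (sNM : hom_subgroup N M) :
  exists nMN : hom_normal_subgroup (quotient_set nN M),
    hom_isomorphic (quotient nMN) (quotient nM).
Proof.
have nMN : hom_normal_subgroup (quotient_set nN M).
  exact: (hom_normal_subgroup_image (quotient_projM nN) (quotient_proj_surj nN) nM).
exists nMN; have [NM _ _ _] := sNM.
apply: (hom_isomorphic_same_fibers _ _ _ (quotient_proj nMN \o quotient_proj nN)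
  (quotient_proj nM)).
- exact: hom_morphism_comp (quotient_projM nN) (quotient_projM nMN).
- exact: quotient_projM.
- move=> A; have [B <-] := quotient_proj_surj nMN A.
  by have [g <-] := quotient_proj_surj nN B; exists g.
- exact: quotient_proj_surj.
- move=> a b; rewrite /= !quotient_proj_eqP.
  exact: hlcoset_image_eq.
Qed.
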